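(* Let $\mathfrak{X} = (X_i)_{i \in \mathbb{N}}$ be a negatively associated sequence of Bernoulli (i.e. $\{0,1\}$-valued) random variables. If $\mathfrak{X}$ has summable covariances, i.e. $\sum_{j=1}^\infty |\mathrm{cov}(X_i,X_j)| < \infty$ for every $i \in \mathbb{N}$, then its tail $\sigma$-field $\mathcal{T}(\mathfrak{X})$ is trivial: $\mathbb{P}(E) \in \{0,1\}$ for every $E \in \mathcal{T}(\mathfrak{X})$.
   Context: The Bernoulli random variables need not be identically distributed. A stochastic process $(X_i)_{i \in \mathbb{N}}$ is negatively associated if $\mathbb{E}[fg] \leq \mathbb{E}[f]\,\mathbb{E}[g]$ for every pair of coordinatewise increasing (i.e. nondecreasing) functions $f$ and $g$ of the process that depend on disjoint subsets of the components (and for which these expectations exist). The tail $\sigma$-field of $\mathfrak{X}$ is $\mathcal{T}(\mathfrak{X}) = \bigcap_{n=1}^\infty \sigma(X_i : i \geq n)$. *)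

(* Defs.v *)
From mathcomp Require Export all_boot all_order all_algebra.
From mathcomp Require Export all_classical all_reals all_analysis.

Set Implicit Arguments.
Unset Strict Implicit.
Unset Printing Implicit Defensive.

Import Order.TTheory GRing.Theory Num.Theory.
Import numFieldNormedType.Exports.

Local Open Scope classical_set_scope.
Local Open Scope ring_scope.

Definition gen_family (T : Type) (d' : measure_display)
    (T' : measurableType d') (I : set nat) (X : nat -> T -> T') :
    set (set T) :=
  \bigcup_(i in I) preimage_set_system setT (X i) measurable.

(* sigma(X_i : i in I) *)
Definition sigma_of (T : Type) (d' : measure_display)
    (T' : measurableType d') (I : set nat) (X : nat -> T -> T') :
    set (set T) :=
  <<s gen_family I X >>.

Definition tail_sigma_field (T : Type) (d' : measure_display)
    (T' : measurableType d') (X : nat -> T -> T') : set (set T) :=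
  \bigcap_n sigma_of [set i | (n <= i)%N] X.

(* R^nat with the product sigma-algebra, i.e. the one generated by the
   coordinate maps. *)
Notation seq_space R :=
  (g_sigma_algebraType
    (gen_family setT (fun (i : nat) (x : nat -> R) => x i))).

Definition coordinatewise_nondecreasing (R : realType)
    (f : (nat -> R) -> R) : Prop :=
  forall x y : nat -> R, (forall i, x i <= y i) -> f x <= f y.

Definition depends_only_on (R : realType) (I : set nat)
    (f : (nat -> R) -> R) : Prop :=
  forall x y : nat -> R, (forall i, I i -> x i = y i) -> f x = f y.

(* The index sets I and J may be infinite: the test functions may depend on
   infinitely many components of the process. *)
Definition negatively_associated (d : measure_display) (T : measurableType d)
    (R : realType) (P : probability T R) (X : nat -> T -> R) : Prop :=
  forall (I J : set nat) (f g : (nat -> R) -> R),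
    I `&` J = set0 ->
    depends_only_on I f -> depends_only_on J g ->
    coordinatewise_nondecreasing f -> coordinatewise_nondecreasing g ->
    measurable_fun setT (f : seq_space R -> R) ->
    measurable_fun setT (g : seq_space R -> R) ->
    let fX := fun w => f (fun i => X i w) in
    let gX := fun w => g (fun i => X i w) in
    P.-integrable setT (EFin \o fX) ->
    P.-integrable setT (EFin \o gX) ->
    P.-integrable setT (EFin \o (fX \* gX)) ->
    ('E_P[fX \* gX] <= 'E_P[fX] * 'E_P[gX])%E.

(* Main.v *)
(* Let A be an event of (X_i)_{i in s} and B an event of (X_j)_{j in t}, with s
   and t finite and disjoint, and put S = sum_s X_i, U = sum_t X_j.  Since the
   X_i are {0,1}-valued, S +- 1_A and U +- 1_B are nondecreasing, so negative
   association gives cov(S + a 1_A, U + b 1_B) <= 0 for a, b = +-1.  Adding the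
   two inequalities with ab = 1, and the two with ab = -1, cancels the mixed
   terms and leaves |cov(1_A, 1_B)| <= - cov(S, U).  A tail event E is
   approximated in probability by some A of the coordinates in [0, n), and, for
   every m, by some B of the coordinates in [m, M).  Summability makes cov(S, U)
   small for m large, uniformly in M, so P(E) = P(E)^2. *)
Require Import Defs.
From mathcomp Require Import all_boot all_order all_algebra.
From mathcomp Require Import all_classical all_reals all_analysis.
From mathcomp Require Import measurable_realfun lra.

Set Implicit Arguments.
Unset Strict Implicit.
Unset Printing Implicit Defensive.

Import Order.TTheory GRing.Theory Num.Theory.
Import numFieldNormedType.Exports.

Local Open Scope classical_set_scope.
Local Open Scope ring_scope.

(** * Real-valued probabilities, and approximation of events by an algebra of events *)

Section probability_real.
Context (d : measure_display) (T : measurableType d) (R : realType)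
  (P : probability T R).

Lemma fine_probK (A : set T) : measurable A -> (fine (P A))%:E = P A.
Proof. by move=> mA; rewrite fineK// fin_num_measure. Qed.

Lemma fine_prob_ge0 (A : set T) : 0 <= fine (P A).
Proof. exact/fine_ge0/measure_ge0. Qed.

Lemma fine_prob_le1 (A : set T) : measurable A -> fine (P A) <= 1.
Proof. by move=> mA; rewrite -lee_fin fine_probK// probability_le1. Qed.

Lemma fine_prob_subU (A B C : set T) :
  measurable A -> measurable B -> measurable C -> A `<=` B `|` C ->
  fine (P A) <= fine (P B) + fine (P C).
Proof.
move=> mA mB mC ABC; rewrite -lee_fin EFinD !fine_probK//.
apply: le_trans (measureU2 _ mB mC).
by apply: le_measure => //; rewrite inE//; apply: measurableU.
Qed.

(** Closeness in the pseudo-metric P(B Δ C), with the two halves of the symmetric difference bounded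
    separately. *)
Definition approximable (G : set_system T) (B : set T) :=
  forall e : R, 0 < e -> exists C,
    [/\ G C, fine (P (B `\` C)) <= e & fine (P (C `\` B)) <= e].

Section approximation.
Variable G : set_system T.
Hypotheses (GM : G `<=` measurable) (G0 : G set0)
  (GC : forall A, G A -> G (~` A))
  (GU : forall A B, G A -> G B -> G (A `|` B)).

Lemma approximableU (A B : set T) : measurable A -> measurable B ->
  approximable G A -> approximable G B -> approximable G (A `|` B).
Proof.
move=> mA mB apA apB e e0.
have e20 : 0 < e / 2 by rewrite divr_gt0.
have [C [GC' AC CA]] := apA _ e20; have [D [GD BD DB]] := apB _ e20.
have mC := GM GC'; have mD := GM GD.
exists (C `|` D); split; first exact: GU.
- rewrite [e]splitr; apply: le_trans (lerD AC BD).
  apply: fine_prob_subU.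
  - by apply: measurableD; apply: measurableU.
  - exact: measurableD.
  - exact: measurableD.
  by move=> x [[Ax|Bx] /not_orP[nC nD]]; [left|right].
- rewrite [e]splitr; apply: le_trans (lerD CA DB).
  apply: fine_prob_subU.
  - by apply: measurableD; apply: measurableU.
  - exact: measurableD.
  - exact: measurableD.
  by move=> x [[Ax|Bx] /not_orP[nC nD]]; [left|right].
Qed.

(** The finite unions [U n] increase to the whole union, so by continuity from below some [U N]
    misses at most e/2 of it. Approximating [U N] to within e/2 costs the other half. *)
Lemma approximable_bigcup (F : (set T)^nat) :
  (forall n, measurable (F n)) -> (forall n, approximable G (F n)) ->
  approximable G (\bigcup_n F n).
Proof.
move=> mF apF e e0.
pose U n := \big[setU/set0]_(i < n) F i.
have mU n : measurable (U n) by apply: bigsetU_measurable.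
have apU n : approximable G (U n).
  elim: n => [|n IH]; rewrite /U.
    rewrite big_ord0 => e' e'0; exists set0; split=> //;
      by rewrite setD0 measure0 ltW.
  by rewrite big_ord_recr/=; apply: approximableU => //; exact: mU.
have mB : measurable (\bigcup_n F n) by apply: bigcup_measurable.
have e20 : 0 < e / 2 by rewrite divr_gt0.
have UE : \bigcup_n U n = \bigcup_n F n.
  rewrite eqEsubset; split=> x [n _].
    by rewrite /U -bigcup_mkord => -[i _ Fx]; exists i.
  by move=> Fx; exists n.+1 => //; rewrite /U -bigcup_mkord; exists n => /=.
have cvU : fine (P (U n)) @[n --> \oo] --> fine (P (\bigcup_n F n)).
  apply: fine_cvg; rewrite fine_probK// -UE.
  apply: (@nondecreasing_cvg_mu _ _ _ P U) => //.
  - by rewrite UE.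
  - by move=> m n mn; apply/subsetPset; exact: subset_bigsetU.
have UB n : U n `<=` \bigcup_n F n.
  by rewrite -UE; apply: bigcup_sup.
have [N _ /(_ N (leqnn _)) BUN] := (cvgrPdist_le _ _).1 cvU _ e20.
have [C [GC' UC CU]] := apU N _ e20.
have mC := GM GC'.
exists C; split=> //.
- rewrite [e]splitr.
  have BU : fine (P (\bigcup_n F n `\` U N)) <= e / 2.
    apply: le_trans BUN; apply: le_trans (ler_norm _).
    rewrite measureD//; last by rewrite ltey_eq fin_num_measure.
    have -> : \bigcup_n F n `&` U N = U N by apply/setIidr.
    by rewrite fineB// fin_num_measure.
  apply: le_trans (lerD BU UC).
  apply: fine_prob_subU; do ?exact: measurableD.
  by move=> x [Bx nC]; have [Ux|nU] := pselect (U N x); [right|left].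
- apply: (@le_trans _ _ (e / 2)); last by rewrite ler_pdivrMr// ler_pMr// ler1n.
  apply: le_trans CU; rewrite fine_le ?fin_num_measure//; do ?exact: measurableD.
  apply: le_measure; rewrite ?inE; do ?exact: measurableD.
  by move=> x [Cx nB]; split=> // /UB.
Qed.

(** The measurable approximable sets form a sigma-algebra containing [G]. Measurability is carried
    along because the countable union step uses continuity of the measure. *)
Lemma approximable_generated (B : set T) : <<s G >> B -> approximable G B.
Proof.
suff: <<s G >> `<=` [set A | measurable A /\ approximable G A].
  by move=> h /h[].
apply: smallest_sub; last first.
  move=> A GA; split; first exact: GM.
  by move=> e e0; exists A; split=> //; rewrite setDv measure0 ltW.
split.
- split=> // e e0; exists set0; split=> //; by rewrite setDv measure0 ltW.
(* Complementing both the set and its approximant swaps the two differences. *)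
- move=> A [mA apA]; rewrite setTD; split; first exact: measurableC.
  move=> e /apA[C [GC' AC CA]]; exists (~` C); split; first exact: GC.
    by rewrite setDE setCK setIC -setDE.
  by rewrite setDE setCK setIC -setDE.
- move=> F FP; split.
    by apply: bigcup_measurable => n _; have [] := FP n.
  by apply: approximable_bigcup => n; have [] := FP n.
Qed.

End approximation.

(** * Square-integrability and bilinearity of covariance *)

Lemma Lfun2_bounded1 (f : T -> R) : measurable_fun setT f ->
  (forall w, `|f w| <= 1) -> f \in Lfun P 2%:E.
Proof.
move=> mf f1; rewrite inE/=; apply/andP; split; rewrite inE//=.
rewrite /finite_norm unlock poweR_lty//.
apply: (@le_lt_trans _ _ (\int[P]_x cst 1 x)%E); last first.
  by rewrite integral_cst// mul1e ltey_eq fin_num_measure.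
apply: ge0_le_integral => //.
- by move=> x _; rewrite lee_fin powR_ge0.
- apply/measurable_EFinP; apply: (measurableT_comp (measurable_powR _)).
  exact: measurableT_comp.
- move=> x _; rewrite /= lee_fin.
  apply: (@le_trans _ _ (1 `^ 2)); last by rewrite powR1.
  by rewrite ge0_ler_powR// ?nnegrE.
Qed.

Lemma Lfun2_indic (A : set T) : measurable A -> \1_A \in Lfun P 2%:E.
Proof.
move=> mA; apply: Lfun2_bounded1 => // w.
by rewrite indicE; case: (w \in A); rewrite ?normr1 ?normr0.
Qed.

Lemma Lfun21 (f : T -> R) : f \in Lfun P 2%:E -> f \in Lfun P 1.
Proof. by apply: Lfun_subset12; rewrite fin_num_measure. Qed.

Lemma covariance_fin2 (f g : T -> R) : f \in Lfun P 2%:E ->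
  g \in Lfun P 2%:E -> covariance P f g \is a fin_num.
Proof.
by move=> f2 g2; rewrite covariance_fin_num ?Lfun2_mul_Lfun1 ?Lfun21.
Qed.

Lemma covariance_indic (A B : set T) : measurable A -> measurable B ->
  fine (covariance P \1_A \1_B) = fine (P (A `&` B)) - fine (P A) * fine (P B).
Proof.
move=> mA mB; have A2 := Lfun2_indic mA; have B2 := Lfun2_indic mB.
rewrite covarianceE ?Lfun2_mul_Lfun1 ?Lfun21//.
rewrite (_ : \1_A * \1_B = \1_(A `&` B)); last by rewrite indicI.
rewrite !expectation_indic//; last exact: measurableI.
rewrite fineB ?fineM ?fin_numM ?fin_num_measure//; exact: measurableI.
Qed.

(** Meant for [f], [h] sums of coordinates, [g], [k] indicators of events and signs [a], [b]: the
    mixed terms carry a single sign, the indicator term carries the product. *)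
Lemma fine_covarianceDZ (a b : R) (f g h k : T -> R) :
  f \in Lfun P 2%:E -> g \in Lfun P 2%:E -> h \in Lfun P 2%:E ->
  k \in Lfun P 2%:E ->
  fine (covariance P (f \+ a \o* g) (h \+ b \o* k)) =
    fine (covariance P f h) + b * fine (covariance P f k)
    + a * fine (covariance P g h) + a * b * fine (covariance P g k).
Proof.
move=> f2 g2 h2 k2.
have ag2 : a \o* g \in Lfun P 2%:E by rewrite Lfun_scale// ler1n.
have bk2 : b \o* k \in Lfun P 2%:E by rewrite Lfun_scale// ler1n.
have Zr u : u \in Lfun P 2%:E ->
    covariance P u (b \o* k) = (b%:E * covariance P u k)%E.
  by move=> u2; rewrite covarianceZr ?Lfun2_mul_Lfun1 ?Lfun21.
have Zl u : u \in Lfun P 2%:E ->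
    covariance P (a \o* g) u = (a%:E * covariance P g u)%E.
  by move=> u2; rewrite covarianceZl ?Lfun2_mul_Lfun1 ?Lfun21.
rewrite covarianceDl ?rpredD ?lee1n// !covarianceDr// Zl// Zl// Zr// Zr//.
rewrite !fineD ?fineM ?fin_numD ?fin_numM ?covariance_fin2//.
by rewrite !addrA mulrA.
Qed.

Lemma Lfun2_sum (X : nat -> T -> R) (s : seq nat) :
  (forall i, X i \in Lfun P 2%:E) ->
  (fun w => \sum_(i <- s) X i w) \in Lfun P 2%:E.
Proof.
move=> X2; rewrite (_ : (fun _ => _) = \sum_(i <- s) X i); last first.
  by apply/funext => w; rewrite fct_sumE.
by apply: rpred_sum; rewrite ?lee1n.
Qed.

Lemma fine_covariance_suml (X : nat -> T -> R) (s : seq nat) (g : T -> R) :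
  (forall i, X i \in Lfun P 2%:E) -> g \in Lfun P 2%:E ->
  fine (covariance P (fun w => \sum_(i <- s) X i w) g) =
    \sum_(i <- s) fine (covariance P (X i) g).
Proof.
move=> X2 g2; elim: s => [|i s IH].
  rewrite big_nil (_ : (fun _ => _) = cst 0) ?covariance_cst_l//.
  by apply/funext => w; rewrite big_nil.
rewrite big_cons -IH -fineD ?covariance_fin2 ?Lfun2_sum//.
rewrite -covarianceDl ?Lfun2_sum//; congr (fine (covariance P _ _)).
by apply/funext => w; rewrite big_cons.
Qed.

Lemma fine_covariance_sum (X : nat -> T -> R) (s t : seq nat) :
  (forall i, X i \in Lfun P 2%:E) ->
  fine (covariance P (fun w => \sum_(i <- s) X i w)
                     (fun w => \sum_(j <- t) X j w)) =
    \sum_(i <- s) \sum_(j <- t) fine (covariance P (X i) (X j)).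
Proof.
move=> X2; rewrite fine_covariance_suml ?Lfun2_sum//.
apply: eq_bigr => i _; rewrite covarianceC fine_covariance_suml//.
by apply: eq_bigr => j _; rewrite covarianceC.
Qed.

End probability_real.

(** * Events determined by a set of coordinates *)

Section sigma_of_lemmas.
Context (T : Type) (R : realType).
Implicit Types (X : nat -> T -> R) (I J : set nat).

Lemma sigma_of_sub X I J : I `<=` J -> sigma_of I X `<=` sigma_of J X.
Proof.
move=> IJ; apply: smallest_sub; first exact: smallest_sigma_algebra.
by move=> A [i Ii XA]; apply: sub_sigma_algebra; exists i => //; exact: IJ.
Qed.

(** The analogue of [depends_only_on] for sets. One implication is enough, since [x] and [y] can be
    exchanged. *)
Definition in_coordinates I (C : set (nat -> R)) :=
  forall x y, (forall i, I i -> x i = y i) -> C x -> C y.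

(** A Doob-Dynkin factorization for events: the sets of this form are a sigma-algebra containing the
    generators. It turns events into functions of the sequence, as negative association requires. *)
Lemma sigma_of_preimage X I (B : set T) : sigma_of I X B ->
  exists C : set (seq_space R),
    [/\ measurable C, in_coordinates I C & B = [set w | C (X ^~ w)]].
Proof.
pose D := [set A : set T | exists C : set (seq_space R),
  [/\ measurable C, in_coordinates I C & A = [set w | C (X ^~ w)]]].
suff: sigma_of I X `<=` D by apply.
apply: smallest_sub.
  split.
  - by exists set0; split.
  - move=> A [C [mC dC ->]]; exists (~` C); split.
    + exact: measurableC.
    + move=> x y xy nCx Cy; apply: nCx; apply: dC Cy => i Ii.
      by rewrite xy.
    + by rewrite setTD.
  - move=> F /choice[C CP]; exists (\bigcup_n C n); split.
    + by apply: bigcup_measurable => n _; have [] := CP n.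
    + move=> x y xy [n _ Cx]; exists n => //.
      by have [_ dC _] := CP n; apply: dC Cx.
    + rewrite eqEsubset; split=> w [n _] h; exists n => //;
        by have [_ _ E] := CP n; move: h; rewrite E.
move=> _ [i Ii [B' mB' <-]].
exists [set x : nat -> R | B' (x i)]; split.
- by apply: sub_sigma_algebra; exists i => //; exists B' => //; rewrite setTI.
- by move=> x y xy /=; rewrite xy.
- by rewrite setTI.
Qed.

End sigma_of_lemmas.

(** * Monotone test functions: a count perturbed by an indicator *)

Section tilted_count.
Context (R : realType).
Implicit Types (x y : nat -> R) (s : seq nat) (C : set (nat -> R)).

(** Test functions must be monotone on all real sequences, not only on binary ones. This
    nondecreasing map onto binary sequences fixes every binary sequence. *)
Definition level x (i : nat) : R := (1 <= x i)%R%:R.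

(** Along a Bernoulli process this is S + a 1_A, where A is the event that the path lies in [C]. *)
Definition tilted_count s (a : R) C x :=
  \sum_(i <- s) level x i + \1_C (level x) * a.

Lemma tilted_count_depends s a C : in_coordinates [set` s] C ->
  depends_only_on [set` s] (tilted_count s a C).
Proof.
move=> dC x y xy; have lxy i : i \in s -> level x i = level y i.
  by move=> /xy; rewrite /level => ->.
congr (_ + _ * _); first by apply: eq_big_seq => i /lxy.
rewrite !indicE; congr (_%:R); congr nat_of_bool.
by apply/idP/idP; rewrite !inE; apply: dC => i /lxy.
Qed.

(* Raising a coordinate of [s] across 1 adds at least 1 to the count, which
   absorbs any change of the indicator. *)
Lemma tilted_count_nondecreasing s a C : in_coordinates [set` s] C ->
  `|a| <= 1 -> coordinatewise_nondecreasing (tilted_count s a C).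
Proof.
move=> dC a1 x y xy.
have lxy i : level x i <= level y i.
  rewrite /level ler_nat; have := xy i.
  by have [x1|//] := leP 1 (x i) => /(le_trans x1) ->.
(* If no coordinate in [s] changes level, membership in [C] cannot change either, and the two values
   coincide. *)
have [eqs|] := pselect (forall i, i \in s -> level x i = level y i).
  rewrite /tilted_count (eq_big_seq _ eqs) lerD2l le_eqVlt; apply/orP; left.
  apply/eqP; congr (_ * _); rewrite !indicE; congr (_%:R); congr nat_of_bool.
  by apply/idP/idP; rewrite !inE; apply: dC => i /eqs.
move=> /existsNP[i /not_implyP[si nexy]].
have lx : level x i = 0.
  move: nexy (lxy i); rewrite /level.
  by case: (1 <= x i); case: (1 <= y i) => //= _; rewrite ler10.
have ly : level y i = 1.
  by move: nexy; rewrite lx /level; case: (1 <= y i).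
have le_rem : \sum_(j <- rem i s) level x j <= \sum_(j <- rem i s) level y j.
  by apply: ler_sum.
rewrite /tilted_count !(big_rem i si)/= lx ly.
move: a1; rewrite ler_norml => /andP[? ?].
by rewrite !indicE; case: (_ \in C); case: (_ \in C); rewrite /=; lra.
Qed.

Lemma measurable_coordinate (i : nat) :
  measurable_fun setT (fun x : seq_space R => x i).
Proof.
by move=> _ B mB; apply: sub_sigma_algebra; exists i => //; exists B.
Qed.

Lemma measurable_level_coordinate (i : nat) :
  measurable_fun setT (fun x : seq_space R => level x i).
Proof.
rewrite (_ : (fun _ => _) =
    \1_(`[1, +oo[ : set R) \o (fun x : seq_space R => x i)).
  by apply: measurableT_comp => //; exact: measurable_coordinate.
by apply/funext => x; rewrite /level /= indicE mem_setE in_itv/= andbT.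
Qed.

Lemma measurable_level :
  measurable_fun setT (level : seq_space R -> seq_space R).
Proof.
apply: (@measurability _ _ (seq_space R) (seq_space R) setT level
  (gen_family setT (fun i (x : nat -> R) => x i))) => //.
move=> _ [_ [i _ [B mB <-]] <-]; rewrite !setTI.
by rewrite -[X in measurable X]setTI; exact: measurable_level_coordinate.
Qed.

Lemma measurable_tilted_count s a (C : set (seq_space R)) : measurable C ->
  measurable_fun setT (tilted_count s a C : seq_space R -> R).
Proof.
move=> mC; apply: measurable_funD.
  by apply: measurable_sum => i; exact: measurable_level_coordinate.
apply: measurable_funM => //; apply: measurableT_comp measurable_level.
exact: measurable_indic.
Qed.

End tilted_count.

(** * Negative association bounds the dependence between events *)

Section negatively_associated_bernoulli.
Context (d : measure_display) (T : measurableType d) (R : realType)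
  (P : probability T R) (X : nat -> {RV P >-> R}).
Hypotheses (X01 : forall i w, X i w = 0 \/ X i w = 1)
  (X_na : negatively_associated P (fun i => X i : T -> R)).

Local Notation Xf := (fun i => X i : T -> R).

Lemma sigma_of_measurable (I : set nat) : sigma_of I Xf `<=` measurable.
Proof.
apply: smallest_sub; first exact: sigma_algebra_measurable.
by move=> _ [i Ii [B mB <-]]; exact: measurable_funPT.
Qed.

Lemma bernoulli_Lfun2 i : (X i : T -> R) \in Lfun P 2%:E.
Proof.
apply: Lfun2_bounded1 => // w.
by case: (X01 i w) => ->; rewrite ?normr0 ?normr1.
Qed.

Let sumX2 (r : seq nat) : (fun w => \sum_(i <- r) X i w) \in Lfun P 2%:E.
Proof. exact: (Lfun2_sum r bernoulli_Lfun2). Qed.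

(** Binary paths are fixed by [level], so the two variables are tilted counts of the process. These
    are nondecreasing in disjoint sets of coordinates, and their square-integrability supplies the
    integrability conditions of negative association. *)
Lemma covariance_tilted_le0 (s t : seq nat) (a b : R) (A B : set T) :
  (forall i, i \in s -> i \notin t) -> `|a| <= 1 -> `|b| <= 1 ->
  sigma_of [set` s] Xf A -> sigma_of [set` t] Xf B ->
  fine (covariance P ((fun w => \sum_(i <- s) X i w) \+ a \o* \1_A)
                     ((fun w => \sum_(j <- t) X j w) \+ b \o* \1_B)) <= 0.
Proof.
move=> st a1 b1 sA tB.
have mA := sigma_of_measurable sA; have mB := sigma_of_measurable tB.
have [C [mC dC AC]] := sigma_of_preimage sA.
have [D [mD dD BD]] := sigma_of_preimage tB.
have levelX w : level (Xf ^~ w) = Xf ^~ w.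
  apply/funext => i; rewrite /level.
  by case: (X01 i w) => ->; rewrite ?lexx ?ler10.
have tiltX r c K : (fun w => tilted_count r c K (Xf ^~ w)) =
    ((fun w => \sum_(i <- r) X i w) \+ c \o* \1_[set w | K (Xf ^~ w)]).
  by apply/funext => w; rewrite /tilted_count levelX /= !indicE.
have L2 r c K : measurable K ->
    (fun w => \sum_(i <- r) X i w) \+ c \o* \1_K \in Lfun P 2%:E.
  move=> mK; rewrite rpredD ?lee1n// => ?.
  by rewrite Lfun_scale ?ler1n ?Lfun2_indic.
have F2 := L2 s a _ mA; have G2 := L2 t b _ mB.
have st0 : [set` s] `&` [set` t] = set0.
  by apply/seteqP; split=> i //= [/st/negP].
have := X_na st0 (tilted_count_depends _ dC) (tilted_count_depends _ dD)
  (tilted_count_nondecreasing dC a1) (tilted_count_nondecreasing dD b1)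
  (measurable_tilted_count _ _ mC) (measurable_tilted_count _ _ mD).
have F1 := Lfun21 F2; have G1 := Lfun21 G2.
have FG1 := Lfun2_mul_Lfun1 F2 G2.
rewrite /= !tiltX -AC -BD => /(_ ((Lfun1_integrable _ _).1 F1)
  ((Lfun1_integrable _ _).1 G1) ((Lfun1_integrable _ _).1 FG1)) na.
apply: fine_le0; rewrite covarianceE//.
by rewrite leeBlDr ?add0e// fin_numM ?expectation_fin_num.
Qed.

Lemma covariance_indic_le (s t : seq nat) (A B : set T) :
  (forall i, i \in s -> i \notin t) ->
  sigma_of [set` s] Xf A -> sigma_of [set` t] Xf B ->
  `|fine (P (A `&` B)) - fine (P A) * fine (P B)| <=
    \sum_(i <- s) \sum_(j <- t) `|fine (covariance P (X i) (X j))|.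
Proof.
move=> st sA tB.
have mA := sigma_of_measurable sA; have mB := sigma_of_measurable tB.
have tilted a b : `|a| <= 1 -> `|b| <= 1 -> _ :=
  fun a1 b1 => covariance_tilted_le0 st a1 b1 sA tB.
have n1 : `|1 : R| <= 1 by rewrite normr1.
have nN1 : `|-1 : R| <= 1 by rewrite normrN normr1.
apply: (@le_trans _ _ `|\sum_(i <- s) \sum_(j <- t)
    fine (covariance P (X i) (X j))|); last first.
  apply: le_trans (ler_norm_sum _ _ _) _; apply: ler_sum => i _.
  exact: ler_norm_sum.
rewrite -covariance_indic// -(fine_covariance_sum s t bernoulli_Lfun2).
move: (tilted _ _ n1 n1) (tilted _ _ nN1 nN1)
  (tilted _ _ n1 nN1) (tilted _ _ nN1 n1).
rewrite !fine_covarianceDZ ?Lfun2_indic ?sumX2//.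
set u := fine (covariance P \1_A \1_B); set v := fine (covariance P _ _).
set x := fine _; set y := fine _ => h1 h2 h3 h4.
(* With mixed terms [x] and [y], half of [h1] + [h2] reads v + u <= 0 and half of [h3] + [h4] reads
   v - u <= 0. *)
have vu : `|u| <= - v by rewrite ler_norml; apply/andP; split; lra.
by apply: le_trans vu _; rewrite -normrN ler_norm.
Qed.

End negatively_associated_bernoulli.

(** * Uniform smallness of finitely many tails of series *)

Lemma tail_sum_small (R : realType) (c : nat -> nat -> R) (n : nat) (e : R) :
  (forall i j, 0 <= c i j) ->
  (forall i, (\sum_(0 <= j <oo) (c i j)%:E < +oo)%E) -> 0 < e ->
  exists2 m, (n <= m)%N & forall M,
    \sum_(i <- index_iota 0 n) \sum_(j <- index_iota m M) c i j <= e.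
Proof.
move=> c0 coo e0.
(* Each of the [n] rows gets the share e/(n+1); the successor keeps the divisor nonzero when [n] is
   0. *)
have en0 : 0 < e / n.+1%:R by rewrite divr_gt0.
have row i : \forall m \near \oo,
    forall M, \sum_(j <- index_iota m M) c i j <= e / n.+1%:R.
  have cE0 j : true -> (0 <= (c i j)%:E)%E by rewrite lee_fin.
  have /fine_cvgP[tail_fin tail0] := nneseries_tail_cvg (coo i) cE0.
  have tail_lt := (cvgrPdist_le _ _).1 tail0 _ en0.
  near=> m => M; rewrite -lee_fin -sumEFin.
  (* Nonnegativity bounds every partial sum by the full tail from [m], whence the uniformity in
     [M]. *)
  apply: (le_trans (nneseries_lim_ge M (fun j _ => cE0 j))).
  have mfin : (\sum_(m <= j <oo) (c i j)%:E)%E \is a fin_num by near: m.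
  rewrite -(fineK mfin) lee_fin; apply: le_trans (ler_norm _) _.
  rewrite -normrN -[X in `|X|]add0r; near: m; exact: tail_lt.
have rows : \forall m \near \oo, forall i : 'I_n,
    forall M, \sum_(j <- index_iota m M) c i j <= e / n.+1%:R.
  by apply: filter_forall => i; exact: row.
have [m [mrow nm]] : exists m, (forall i : 'I_n,
    forall M, \sum_(j <- index_iota m M) c i j <= e / n.+1%:R) /\ (n <= m)%N.
  have ge_n := nbhs_infty_ge n.
  by have [m ?] := @filter_ex _ _ _ _ (filterI rows ge_n); exists m.
exists m => // M; rewrite big_mkord.
apply: (@le_trans _ _ (\sum_(i < n) e / n.+1%:R)).
  by apply: ler_sum => i _.
rewrite sumr_const card_ord -[leLHS]mulr_natr mulrAC ler_pdivrMr ?ltr0n//.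
by rewrite ler_pM2l// ler_nat.
Unshelve. all: by end_near. Qed.

(** * Approximation by events of finitely many coordinates *)

Section finite_window.
Context (d : measure_display) (T : measurableType d) (R : realType)
  (P : probability T R) (X : nat -> {RV P >-> R}).

Local Notation Xf := (fun i => X i : T -> R).

(** The events of the windows [m, M), over all [M], form an algebra because the windows are nested,
    and this algebra generates the sigma-field of the coordinates from [m] on. *)
Lemma sigma_of_approximable (m : nat) (B : set T) (e : R) :
  sigma_of [set i | (m <= i)%N] Xf B -> 0 < e ->
  exists M A, [/\ sigma_of [set` index_iota m M] Xf A,
    fine (P (B `\` A)) <= e & fine (P (A `\` B)) <= e].
Proof.
move=> mB e0.
pose G := [set A | exists M, sigma_of [set` index_iota m M] Xf A].
have alg M := @smallest_sigma_algebra _ setT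
  (gen_family [set` index_iota m M] Xf).
have GM : G `<=` measurable by move=> A [M]; exact: sigma_of_measurable.
have G0 : G set0 by exists 0%N; have [] := alg 0%N.
have GC A : G A -> G (~` A).
  by move=> [M sA]; exists M; have [_ C _] := alg M; rewrite -setTD; exact: C.
have mono M N : (M <= N)%N ->
    sigma_of [set` index_iota m M] Xf `<=` sigma_of [set` index_iota m N] Xf.
  move=> MN; apply: sigma_of_sub => i /=; rewrite !mem_index_iota.
  by move=> /andP[-> /= /leq_trans]; exact.
have GU A C : G A -> G C -> G (A `|` C).
  move=> [M sA] [N sC]; exists (maxn M N).
  rewrite -bigcup2E; have [s0 _ bc] := alg (maxn M N); apply: bc => -[|[|k]]//=.
    exact: mono (leq_maxl _ _) _ sA.
  exact: mono (leq_maxr _ _) _ sC.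
suff /(approximable_generated P GM G0 GC GU)/(_ _ e0) : <<s G >> B.
  by move=> [A [[M sA] BA AB]]; exists M, A.
move: B mB; apply: smallest_sub; first exact: smallest_sigma_algebra.
(* Windows are half-open, so the one that ends at i+1 is the first to contain the coordinate [i]. *)
move=> A [i /= mi XA]; apply: sub_sigma_algebra; exists i.+1.
by apply: sub_sigma_algebra; exists i => //=; rewrite mem_index_iota mi ltnSn.
Qed.

End finite_window.

(** * Asymptotic independence of a tail event from itself *)

Theorem theorem1p1 (d : measure_display) (T : measurableType d) (R : realType)
    (P : probability T R) (X : nat -> {RV P >-> R})
    (X_bernoulli : forall i w, X i w = 0 \/ X i w = 1)
    (X_na : negatively_associated P (fun i => X i : T -> R))
    (X_summable_cov : forall i,
      (\sum_(0 <= j <oo) `|covariance P (X i) (X j)| < +oo)%E)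
    (E : set T) (E_tail : tail_sigma_field (fun i => X i : T -> R) E) :
  (P E = 0 \/ P E = 1)%E.
Proof.
have mE : measurable E := sigma_of_measurable (E_tail 0%N I).
have X2 := bernoulli_Lfun2 X_bernoulli.
set p := fine (P E).
have p0 : 0 <= p := fine_prob_ge0 P E.
have p1 : p <= 1 := fine_prob_le1 P mE.
suff : p * (1 - p) = 0.
  move=> /eqP; rewrite mulf_eq0 subr_eq0 => /orP[|] /eqP pE.
    by left; rewrite -(fine_probK P mE) -/p pE.
  by right; rewrite -(fine_probK P mE) -/p -pE.
(* The errors add up to 5e: 2e for replacing E by [A] and [B] in the intersection, e for the
   covariance, 2e for the product of probabilities. The bound 6e leaves some slack. *)
suff small e : 0 < e -> p * (1 - p) <= 6 * e.
  apply/eqP; rewrite eq_le mulr_ge0 ?subr_ge0// andbT.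
  apply/ler_addgt0Pl => e e0; rewrite addr0.
  by have := small (e / 6) (divr_gt0 e0 (ltr0n _ 6)); lra.
move=> e0.
have [n [A [sA EA AE]]] := sigma_of_approximable (E_tail 0%N I) e0.
(* The order of choices matters: [m] depends on [n] alone, while [M] is known only once [B] has been
   found for this [m]. Hence the bound for all [M]. *)
have [m nm cov_small] : exists2 m, (n <= m)%N & forall M,
    \sum_(i <- index_iota 0 n) \sum_(j <- index_iota m M)
      `|fine (covariance P (X i) (X j))| <= e.
  apply: tail_sum_small => // i; have := X_summable_cov i.
  by under eq_eseriesr => j _ do rewrite -[X in `|X|%E]fineK ?covariance_fin2//.
have [M [B [sB EB BE]]] := sigma_of_approximable (E_tail m I) e0.
have mA := sigma_of_measurable sA; have mB := sigma_of_measurable sB.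
have disj i : i \in index_iota 0 n -> i \notin index_iota m M.
  rewrite !mem_index_iota /= => i_n; rewrite negb_and -ltnNge.
  by rewrite (leq_trans i_n nm).
have := le_trans (covariance_indic_le X_bernoulli X_na disj sA sB)
  (cov_small M).
have mAB : measurable (A `&` B) by exact: measurableI.
have mEA : measurable (E `\` A) by exact: measurableD.
have mEB : measurable (E `\` B) by exact: measurableD.
have mAE : measurable (A `\` E) by exact: measurableD.
have mBE : measurable (B `\` E) by exact: measurableD.
have split_sub (C D : set T) : C `<=` D `|` (C `\` D).
  by move=> x Cx; have [Dx|nDx] := pselect (D x); [left|right].
have pA : fine (P A) <= p + e.
  apply: le_trans (fine_prob_subU P mA mE mAE (split_sub _ _)) _.
  by rewrite lerD2l.
have pB : fine (P B) <= p + e.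
  apply: le_trans (fine_prob_subU P mB mE mBE (split_sub _ _)) _.
  by rewrite lerD2l.
(* The part of E outside the intersection is the union of [E \ A] and [E \ B], each of probability
   at most e. *)
have pAB : p <= fine (P (A `&` B)) + (e + e).
  have mC : measurable ((E `\` A) `|` (E `\` B)) by exact: measurableU.
  apply: le_trans (fine_prob_subU P mE mAB mC _) _.
    by rewrite -setDIr; exact: split_sub.
  rewrite lerD2l; apply: le_trans (fine_prob_subU P mC mEA mEB _) _ => //.
  exact: lerD.
have B1 := fine_prob_le1 P mB.
rewrite ler_norml => /andP[_ indep].
(* Expanding (p + e) P(B) with P(B) <= p + e in one term and P(B) <= 1 in the other gives p^2 + pe +
   e, and p <= 1. *)
have : fine (P A) * fine (P B) <= p * p + 2 * e.
  apply: (@le_trans _ _ ((p + e) * fine (P B))).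
    by rewrite ler_wpM2r// fine_prob_ge0.
  have : p * fine (P B) <= p * (p + e) by rewrite ler_wpM2l.
  have : e * fine (P B) <= e by rewrite ler_piMr// ltW.
  have : p * e <= e by rewrite ler_piMl// ltW.
  lra.
lra.
Qed.
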